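(* Let $F$ be the neural-network feature map defined in the context, with $\varphi(t)=\max(0,t)$ for all $t\in\mathbb{R}$, $x_0\in\mathbb{R}^d$ and $J\subset\{1,\dots,M\}$. Assume that there exist $\alpha>1$ and $\eta>0$ with $\int_{\mathbb{R}^d}\exp[\eta\|x\|^\alpha]\,\mathrm{d}\mu(x)<+\infty$, and that $\mu(A)>0$ for every non-empty open set $A\subset\mathbb{R}^d$. Assume moreover that for every $j\in\{1,\dots,M\}$ and $k\in\{1,\dots,c_jn_j\}$, $$e_{k,j}^{\top}A_j(\mathcal{G}_{j-1}(x_0))\ne0,$$ where $(e_{k,j})_{1\le k\le c_jn_j}$ is the canonical basis of $\mathbb{R}^{c_jn_j}$. Assume finally that the family $(v_{j,k})_{j\in J,\,k\in\{1,\dots,c_j\}}$ of vectors of $\mathbb{R}^d$ is linearly independent. Then there exists a solution $\theta^\star$ of (Q), and $\pi_{\theta^\star}$ is the solution of (P).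
   Context: Network. $M\in\mathbb{N}$, $M\geq 1$; $(n_j)_{0\le j\le M}$, $(c_j)_{0\le j\le M}$ are positive integers with $n_0=d$, $c_0=1$. For $j\in\{1,\dots,M\}$ and $k\in\{1,\dots,c_j\}$, $A_j^k:\mathbb{R}^{c_{j-1}n_{j-1}}\to\mathbb{R}^{n_j}$ is an affine map, and $A_j=(A_j^k)_{1\le k\le c_j}:\mathbb{R}^{c_{j-1}n_{j-1}}\to\mathbb{R}^{c_jn_j}$ is the stacked affine map; $\tilde A_j$ denotes the linear part (matrix) of $A_j$. $\varphi$ acts coordinatewise on vectors. $\mathcal{G}_0(x)=x$, $\mathcal{G}_j(x)=\varphi(A_j(\mathcal{G}_{j-1}(x)))\in\mathbb{R}^{c_jn_j}$, with channels $\mathcal{G}_j^k(x)=\varphi(A_j^k(\mathcal{G}_{j-1}(x)))\in\mathbb{R}^{n_j}$. With $\overline{\mathcal{G}}_j^k(x)=n_j^{-1}\sum_{\ell=1}^{n_j}\mathcal{G}_j^k(x)(\ell)$, the feature map is $F(x)=(\overline{\mathcal{G}}_j^k(x)-\overline{\mathcal{G}}_j^k(x_0))_{j\in J,\,k\in\{1,\dots,c_j\}}\in\mathbb{R}^p$, $p=\sum_{j\in J}c_j$; so $F(x_0)=0$. The vectors $v_{j,k}$. $D_j(x_0)$ is the $c_jn_j\times c_jn_j$ diagonal matrix with $D_j(x_0)(i,i)=1$ if the $i$-th coordinate of $\mathcal{G}_j(x_0)$ is $>0$ and $0$ otherwise; $\tilde A_{j,+}=D_j(x_0)\tilde A_j$.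 For $j\in J$, $k\in\{1,\dots,c_j\}$, $\tilde v_{j,k}\in\mathbb{R}^{c_jn_j}$ is the vector whose coordinate at (channel $k'$, position $\ell$) is $n_j^{-1}$ if $k'=k$ and $0$ if $k'\ne k$ (so $\tilde v_{j,k}^{\top}\mathcal{G}_j(x)=\overline{\mathcal{G}}_j^k(x)$). Then $v_{j,k}=\tilde A_{1,+}^{\top}\cdots\tilde A_{j,+}^{\top}\tilde v_{j,k}\in\mathbb{R}^d$. Optimization problems. $\mu$ is a Borel probability measure on $\mathbb{R}^d$. $\pi(F)=\int F\,\mathrm{d}\pi$. $\mathcal{P}_1$ is the set of Borel probability measures $\pi$ on $\mathbb{R}^d$ with $\int\|x\|\,\mathrm{d}\pi(x)<+\infty$, and $\mathcal{P}_1^F=\{\pi\in\mathcal{P}_1:\pi(F)=0\}$. $\mathrm{KL}(\pi|\mu)=\int\frac{\mathrm{d}\pi}{\mathrm{d}\mu}\log\frac{\mathrm{d}\pi}{\mathrm{d}\mu}\,\mathrm{d}\mu$ if $\pi\ll\mu$, $+\infty$ otherwise. (P): minimize $\mathrm{KL}(\pi|\mu)$ over $\pi\in\mathcal{P}_1^F$. $\Theta_F=\{\theta\in\mathbb{R}^p:\int\exp[-\langle\theta,F(x)\rangle]\,\mathrm{d}\mu(x)<+\infty\}$. (Q): maximize $\inf_{\pi\in\mathcal{P}_1}\{\mathrm{KL}(\pi|\mu)+\langle\theta,\pi(F)\rangle\}$ over $\theta\in\Theta_F$. For $\theta\in\Theta_F$, $\pi_\theta$ is the probability measure with $\frac{\mathrm{d}\pi_\theta}{\mathrm{d}\mu}(x)=\exp[-\langle\theta,F(x)\rangle-L(\theta)]$,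 $L(\theta)=\log\int\exp[-\langle\theta,F(x)\rangle]\,\mathrm{d}\mu(x)$. *)

(* Defs.v *)
From HB Require Import structures.
From mathcomp Require Import all_boot all_order all_algebra.
From mathcomp Require Import all_classical all_reals all_analysis.

Set Implicit Arguments.
Unset Strict Implicit.
Unset Printing Implicit Defensive.

Import Order.TTheory GRing.Theory Num.Theory.
Import numFieldNormedType.Exports.

Local Open Scope classical_set_scope.
Local Open Scope ring_scope.

(* Vectors of R^m are column matrices 'cV[R]_m. The library topology on them
   comes from the sup norm, hence is the Euclidean one. *)

Definition borelRn (R : realType) (d : nat) :
    measurableType (@open 'cV[R]_d).-sigma :=
  g_sigma_algebraType (@open 'cV[R]_d).

Definition enorm (R : realType) (d : nat) (x : 'cV[R]_d) : R :=
  Num.sqrt (\sum_i x i 0 ^+ 2).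

Definition relu (R : realType) (t : R) : R := Num.max 0 t.

(* Dimension c_j n_j of the j-th layer. The input layer has dimension
   c_0 n_0 = d, so the values of c and n at 0 are never read; values above the
   depth M are harmless. The product c_j n_j is spelled as the sum of c_j copies
   of n_j, so that the library's block-column matrices give the channels. *)
Definition width (d : nat) (c n : nat -> nat) (j : nat) : nat :=
  if j is j'.+1 then (\sum_(k < c j'.+1) n j'.+1)%N else d.

Section Network.
Context (R : realType) (d : nat) (c n : nat -> nat).

Local Notation width := (width d c n).

(* The affine map of channel k in layer j.+1 is y |-> W j k *m y + b j k. *)
Variable W : forall j (k : 'I_(c j.+1)), 'M[R]_(n j.+1, width j).
Variable b : forall j (k : 'I_(c j.+1)), 'cV[R]_(n j.+1).
Variable phi : R -> R.

Definition affine_channel j (k : 'I_(c j.+1)) (y : 'cV[R]_(width j)) :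
    'cV[R]_(n j.+1) :=
  W k *m y + b k.

Definition affine_layer j (y : 'cV[R]_(width j)) : 'cV[R]_(width j.+1) :=
  \mxcol_(k < c j.+1) affine_channel k y.

Definition linear_layer j : 'M[R]_(width j.+1, width j) :=
  \mxcol_(k < c j.+1) W k.

Fixpoint layer_out j (x : 'cV[R]_d) : 'cV[R]_(width j) :=
  match j return 'cV[R]_(width j) with
  | 0%N => x
  | j'.+1 => map_mx phi (affine_layer (layer_out j' x))
  end.

Definition channel_out j (k : 'I_(c j.+1)) (x : 'cV[R]_d) : 'cV[R]_(n j.+1) :=
  map_mx phi (affine_channel k (layer_out j x)).

Definition channel_mean j (k : 'I_(c j.+1)) (x : 'cV[R]_d) : R :=
  (n j.+1)%:R^-1 * \sum_(l < n j.+1) channel_out k x l 0.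

Definition activation_mx j (x0 : 'cV[R]_d) : 'M[R]_(width j) :=
  diag_mx (\row_i (if 0 < layer_out j x0 i 0 then 1 else 0)).

Definition active_linear_layer (x0 : 'cV[R]_d) j :
    'M[R]_(width j.+1, width j) :=
  activation_mx j.+1 x0 *m linear_layer j.

Fixpoint active_tr_prod (x0 : 'cV[R]_d) j : 'cV[R]_(width j) -> 'cV[R]_d :=
  match j return 'cV[R]_(width j) -> 'cV[R]_d with
  | 0%N => id
  | j'.+1 => fun u =>
      active_tr_prod x0 ((active_linear_layer x0 j')^T *m u)
  end.

Definition mean_covector j (k : 'I_(c j.+1)) : 'cV[R]_(width j.+1) :=
  \mxcol_(k' < c j.+1) const_mx (if k' == k then (n j.+1)%:R^-1 else 0).

Definition pulled_mean_covector (x0 : 'cV[R]_d) j (k : 'I_(c j.+1)) :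
    'cV[R]_d :=
  active_tr_prod x0 (mean_covector k).

(* Layers are numbered 1, ..., M: the element i of 'I_M stands for layer i.+1.
   The coordinates of R^p are indexed by the pairs (layer in J, channel). *)
Definition feature_index M (J : {set 'I_M}) : finType :=
  {i : {i : 'I_M | i \in J} & 'I_(c (val (val i)).+1)}.

Definition features M (J : {set 'I_M}) (x0 x : 'cV[R]_d) :
    {ffun feature_index J -> R} :=
  [ffun ik => channel_mean (tagged ik) x - channel_mean (tagged ik) x0].

Definition feature_covector M (J : {set 'I_M}) (x0 : 'cV[R]_d)
    (ik : feature_index J) : 'cV[R]_d :=
  pulled_mean_covector x0 (tagged ik).

End Network.

Section KullbackLeibler.
Context (disp : measure_display) (T : measurableType disp) (R : realType).
Local Open Scope ereal_scope.
Local Open Scope charge_scope.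

Definition density (nu mu : probability T R) : T -> \bar R :=
  'd (charge_of_finite_measure nu) '/d mu.

(* Since ln 0 = 0, the integrand is 0 where the density vanishes. *)
Definition KL (nu mu : probability T R) : \bar R :=
  if `[< nu `<< mu >] then
    \int[mu]_x (fine (density nu mu x) * ln (fine (density nu mu x)))%:E
  else +oo.

End KullbackLeibler.

Section MaximumEntropy.
Context (R : realType) (d : nat) (I : finType).
Variables (mu : probability (borelRn R d) R) (F : 'cV[R]_d -> {ffun I -> R}).

Definition dot (theta y : {ffun I -> R}) : R := \sum_i theta i * y i.

Definition P1 : set (probability (borelRn R d) R) :=
  [set nu : probability (borelRn R d) R | (\int[nu]_x (enorm x)%:E < +oo)%E].

Definition feature_expectation (nu : probability (borelRn R d) R) :
    {ffun I -> R} :=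
  [ffun i => \int[nu]_x F x i].

Definition P1F : set (probability (borelRn R d) R) :=
  [set nu | P1 nu /\ feature_expectation nu = 0].

Definition primal_minimizer (nu : probability (borelRn R d) R) : Prop :=
  P1F nu /\ (forall rho, P1F rho -> (KL nu mu <= KL rho mu)%E).

(* Measures are set functions defined on all sets, so they are compared on
   measurable sets only. *)
Definition is_the_primal_solution (nu : probability (borelRn R d) R) : Prop :=
  primal_minimizer nu /\
  (forall rho, primal_minimizer rho ->
     forall A, measurable A -> rho A = nu A).

Definition ThetaF : set {ffun I -> R} :=
  [set theta | (\int[mu]_x (expR (- dot theta (F x)))%:E < +oo)%E].

Definition dual_value (theta : {ffun I -> R}) : \bar R :=
  ereal_inf
    [set (KL nu mu + (dot theta (feature_expectation nu))%:E)%E | nu in P1].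

Definition is_dual_solution (theta : {ffun I -> R}) : Prop :=
  ThetaF theta /\
  (forall theta', ThetaF theta' -> (dual_value theta' <= dual_value theta)%E).

Definition log_partition (theta : {ffun I -> R}) : R :=
  ln (\int[mu]_x expR (- dot theta (F x))).

Definition is_gibbs (theta : {ffun I -> R})
    (nu : probability (borelRn R d) R) : Prop :=
  nu `<< mu /\
  {ae mu, forall x, density nu mu x =
    (expR (- dot theta (F x) - log_partition theta))%:E}.

End MaximumEntropy.

(* Main.v *)
Require Import Defs.
From HB Require Import structures.
From mathcomp Require Import all_boot all_order all_algebra.
From mathcomp Require Import all_classical all_reals all_analysis.
From mathcomp Require Import measurable_realfun ring lra.

Set Implicit Arguments.
Unset Strict Implicit.
Unset Printing Implicit Defensive.

Import Order.TTheory GRing.Theory Num.Theory.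
Import numFieldNormedType.Exports.

Local Open Scope classical_set_scope.
Local Open Scope ring_scope.

(** Write Z(theta) for the integral of exp(-<theta, F>) against mu. Since F is
    Lipschitz and mu has a super-exponential moment, Z is finite everywhere. The
    signs of all pre-activations are locally constant around x0, so there
    F(x) = (<v_jk, x - x0>)_jk. As the v_jk are free and mu charges open sets,
    Z(theta) >= m exp(c |theta|), hence Z has a minimizer theta_0, and its
    stationarity says that the Gibbs measure pi_0 of theta_0 satisfies
    pi_0(F) = 0.

    Integrating p ln p - p s - p + exp s >= 0, with equality iff p = exp s, where
    p is the density of nu and s = -<theta, F> - ln Z, gives
    KL(nu|mu) + <theta, nu(F)> >= - ln Z(theta), with equality iff nu is the Gibbs
    measure. This makes pi_0 the unique primal solution, with value - ln Z(theta_0),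
    bounds the dual value at theta_0 from below by - ln Z(theta_0), and testing the
    infimum on pi_0 bounds every dual value from above by the same number. *)

(** * Densities *)

Section Density.
Context (disp : measure_display) (T : measurableType disp) (R : realType).
Implicit Types mu nu : probability T R.

Lemma probability_of_density mu (g : T -> R) :
  measurable_fun setT g -> (forall x, 0 <= g x) ->
  (\int[mu]_x (g x)%:E = 1)%E ->
  exists nu : probability T R,
    forall A, measurable A -> nu A = (\int[mu]_(x in A) (g x)%:E)%E.
Proof.
move=> mg g0 g1; pose m := (fun A => \int[mu]_(x in A) (g x)%:E)%E.
have m0 : m set0 = 0%E by rewrite /m integral_set0.
have m_ge0 A : (0 <= m A)%E by apply: integral_ge0 => x _; rewrite lee_fin.
have m_sigma : semi_sigma_additive m.
  apply: semi_sigma_additive_nng_induced; first exact/measurable_EFinP.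
  by move=> x; rewrite lee_fin.
pose m1 : {measure set T -> \bar R} :=
  HB.pack m (isMeasure.Build _ T R m m0 m_ge0 m_sigma).
pose m2 : probability T R := HB.pack (Measure.sort m1) (Measure_isProbability.Build _ _ _ m1 g1).
by exists m2.
Qed.

(** Additivity survives an infinite integral of [u]: [u <= (u + w)^+ + |w|] makes the positive part
    of [u + w] infinite, while [u >= 0] bounds its negative part by [|w|]. This lets infinite
    entropies be split later. *)
Lemma integralD_ge0_integrable mu (u w : T -> R) :
  measurable_fun setT u -> (forall x, 0 <= u x) ->
  mu.-integrable setT (EFin \o w) ->
  (\int[mu]_x (u x + w x)%:E =
   \int[mu]_x (u x)%:E + \int[mu]_x (w x)%:E)%E.
Proof.
move=> meas_u u0 iw.
have mw : measurable_fun setT w.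
  by apply/measurable_EFinP; exact: measurable_int iw.
have [ui|uoo] := boolP ((\int[mu]_x (u x)%:E) < +oo)%E.
  have iu : mu.-integrable setT (EFin \o u).
    apply/integrableP; split; first exact/measurable_EFinP.
    by under eq_integral do rewrite /= ger0_norm//.
  by rewrite -integralD_EFin.
have {}uoo : (\int[mu]_x (u x)%:E = +oo)%E.
  by apply/eqP; move: uoo; rewrite -leNgt leye_eq.
have wfin : (\int[mu]_x (w x)%:E)%E \is a fin_num by exact: integrable_fin_num.
rewrite uoo addye; last by by rewrite gt_eqF ?ltNye_eq ?wfin.
have iaw := integrable_norm iw.
have awfin : (\int[mu]_x `|w x|%:E)%E \is a fin_num by exact: integrable_fin_num.
have muw : measurable_fun setT (fun x => u x + w x) by exact: measurable_funD.
have posoo : (\int[mu]_x ((fun x => (u x + w x)%:E)^\+ x) = +oo)%E.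
  apply/eqP; rewrite -leye_eq leNgt; apply/negP => lty.
  have : (\int[mu]_x (u x)%:E <=
    \int[mu]_x ((fun x => (u x + w x)%:E)^\+ x + `|w x|%:E))%E.
    apply: ge0_le_integral => //.
    - by move=> x _; rewrite lee_fin.
    - exact/measurable_EFinP.
    - by apply: emeasurable_funD; [apply: measurable_funepos; apply/measurable_EFinP|
        apply/measurable_EFinP; apply: measurableT_comp].
    - move=> x _; rewrite funeposE -EFin_max -EFinD lee_fin.
      have h1 : u x + w x <= Num.max (u x + w x) 0 by rewrite le_max lexx.
      have h2 : - w x <= `|w x| by rewrite -normrN ler_norm.
      lra.
  rewrite ge0_integralD//; last 2 first.
    by apply: measurable_funepos; apply/measurable_EFinP.
    by apply/measurable_EFinP; apply: measurableT_comp.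
  rewrite uoo leye_eq => /eqP hoo.
  have awlt : (\int[mu]_x `|w x|%:E < +oo)%E by rewrite ltey_eq awfin.
  by have := lte_add_pinfty lty awlt; rewrite hoo ltxx.
have negfin : (\int[mu]_x ((fun x => (u x + w x)%:E)^\- x) < +oo)%E.
  apply: (@le_lt_trans _ _ (\int[mu]_x `|w x|%:E)%E).
    apply: ge0_le_integral => //.
    - by apply: measurable_funeneg; apply/measurable_EFinP.
    - by apply/measurable_EFinP; apply: measurableT_comp.
    - move=> x _; rewrite funenegE -EFinN -EFin_max lee_fin ge_max normr_ge0 andbT.
      have h2 : - w x <= `|w x| by rewrite -normrN ler_norm.
      have := u0 x; lra.
  by rewrite ltey_eq awfin.
by rewrite integralE posoo addye// -ltNye lteNr.
Qed.

Lemma measurable_density nu mu : nu `<< mu ->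
  measurable_fun setT (density nu mu).
Proof.
move=> numu; apply: (measurable_int mu).
by apply: Radon_Nikodym_integrable.
Qed.

Lemma integral_cst_probability nu (r : R) : (\int[nu]_x r%:E = r%:E)%E.
Proof.
rewrite -[RHS]mule1 -(@probability_setT _ _ _ nu).
exact: (integral_cst nu measurableT r%:E).
Qed.

(** * Integration against a measure through a real version of its density *)

Section VersionOfDensity.
Variables (nu mu : probability T R) (p : T -> R).
Hypothesis numu : nu `<< mu.
Hypothesis mp : measurable_fun setT p.
Hypothesis p0 : forall x, 0 <= p x.
Hypothesis dp : {ae mu, forall x, density nu mu x = (p x)%:E}.

Lemma density_measure A : measurable A -> nu A = (\int[mu]_(x in A) (p x)%:E)%E.
Proof.
move=> mA.
rewrite -[nu A]/(charge_of_finite_measure nu A).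
rewrite (Radon_Nikodym_integral (mu := mu) _ mA); last exact: numu.
apply: ae_eq_integral => //.
- by apply: measurable_funTS; exact: measurable_density.
- by apply: measurable_funTS; apply/measurable_EFinP.
- by apply: filterS dp => x /= + _.
Qed.

(** The change of variables for nonnegative functions is phrased with [Radon_Nikodym_SigmaFinite.f],
    so [p], tied to [density] by [dp], must be tied to that derivative too. *)
Let pRN : ae_eq mu setT (Radon_Nikodym_SigmaFinite.f nu mu) (EFin \o p).
Proof.
have := ae_eq_Radon_Nikodym_SigmaFinite numu measurableT.
by apply: filterS2 dp => x dpx h _; rewrite h.
Qed.

Lemma ge0_integral_density (h : T -> R) :
  measurable_fun setT h -> (forall x, 0 <= h x) ->
  (\int[nu]_x (h x)%:E = \int[mu]_x (h x * p x)%:E)%E.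
Proof.
move=> mh h0.
have mRN : measurable_fun setT (Radon_Nikodym_SigmaFinite.f nu mu).
  by apply: measurable_int; exact: Radon_Nikodym_SigmaFinite.f_integrable.
rewrite -(Radon_Nikodym_SigmaFinite.change_of_variables numu)//; last first.
  exact/measurable_EFinP.
apply: ae_eq_integral => //.
- by apply: emeasurable_funM => //; exact/measurable_EFinP.
- by apply/measurable_EFinP; exact: measurable_funM.
- by apply: filterS pRN => x /= /(_ I) -> _; rewrite EFinM.
Qed.

Lemma integrable_density (h : T -> R) : measurable_fun setT h ->
  nu.-integrable setT (EFin \o h) <-> mu.-integrable setT (fun x => (h x * p x)%:E).
Proof.
move=> mh; have mah : measurable_fun setT (fun x => `|h x|).
  exact: measurableT_comp.
have E : (\int[nu]_x `|(h x)%:E| = \int[mu]_x `|(h x * p x)%:E|)%E.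
  have := ge0_integral_density mah (fun x => normr_ge0 _) => /= ->.
  by apply: eq_integral => x _ /=; rewrite normrM (ger0_norm (p0 x)).
split=> /integrableP[_ H]; apply/integrableP; split.
- by apply/measurable_EFinP; exact: measurable_funM.
- by rewrite -E.
- exact/measurable_EFinP.
- by rewrite E.
Qed.

Lemma integral_density (h : T -> R) : nu.-integrable setT (EFin \o h) ->
  (\int[nu]_x (h x)%:E = \int[mu]_x (h x * p x)%:E)%E.
Proof.
move=> ih.
have mh : measurable_fun setT h.
  by apply/measurable_EFinP; exact: measurable_int ih.
rewrite -(Radon_Nikodym_change_of_variables numu measurableT ih).
apply: ae_eq_integral => //.
- by apply: emeasurable_funM => //; exact/measurable_EFinP.
- by apply/measurable_EFinP; exact: measurable_funM.
- by apply: filterS dp => x /= dpx _; rewrite EFinM; congr (_ * _)%E; exact: dpx.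
Qed.

Lemma KL_density : KL nu mu = (\int[mu]_x (p x * ln (p x))%:E)%E.
Proof.
rewrite /KL asboolT//.
have md : measurable_fun setT (fun x => fine (density nu mu x)).
  by apply: measurableT_comp => //; exact: measurable_density.
have mln (q : T -> R) : measurable_fun setT q ->
    measurable_fun setT (fun x => (q x * ln (q x))%:E).
  move=> mq; apply/measurable_EFinP; apply: measurable_funM => //.
  by apply: measurableT_comp.
apply: ae_eq_integral => //; [exact: mln|exact: mln|].
by apply: filterS dp => x /= -> _.
Qed.

End VersionOfDensity.

(** The sigma-finite derivative is finite and nonnegative at every point, so its [fine] is a version
    with pointwise bounds. *)
Lemma density_version nu mu : nu `<< mu -> exists p : T -> R,
  [/\ measurable_fun setT p, forall x, 0 <= p x &
      {ae mu, forall x, density nu mu x = (p x)%:E}].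
Proof.
move=> numu; exists (fun x => fine (Radon_Nikodym_SigmaFinite.f nu mu x)); split.
- apply: measurableT_comp => //.
  by apply: measurable_int; exact: Radon_Nikodym_SigmaFinite.f_integrable.
- by move=> x; apply: fine_ge0; exact: Radon_Nikodym_SigmaFinite.f_ge0.
- have := ae_eq_Radon_Nikodym_SigmaFinite numu measurableT.
  apply: filterS => x /(_ I) fx; rewrite fineK.
    by rewrite fx.
  exact: Radon_Nikodym_SigmaFinite.f_fin_num.
Qed.

Lemma density_unique nu mu (g : T -> R) :
  measurable_fun setT g -> (forall x, 0 <= g x) ->
  (forall A, measurable A -> nu A = (\int[mu]_(x in A) (g x)%:E)%E) ->
  nu `<< mu /\ {ae mu, forall x, density nu mu x = (g x)%:E}.
Proof.
move=> mg g0 nug.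
have numu : nu `<< mu.
  apply/null_content_dominatesP => A mA A0; rewrite nug//.
  apply: null_set_integral => //.
  by apply: measurable_funTS; exact/measurable_EFinP.
split => //.
have : ae_eq mu setT (density nu mu) (EFin \o g).
  apply: integral_ae_eq => //.
  - by apply: Radon_Nikodym_integrable.
  - exact/measurable_EFinP.
  - by move=> E _ mE; rewrite -Radon_Nikodym_integral//= -nug.
by apply: filterS => x /= /(_ I).
Qed.

End Density.

(** * Minimizing the partition function *)

Lemma lipschitz_at_continuous (R : realType) (V : normedModType R) (f : V -> R)
    (x : V) :
  (exists K, forall y, `|y - x| <= 1 -> `|f y - f x| <= K * `|y - x|) ->
  {for x, continuous f}.
Proof.
move=> [K fK]; apply/cvgrPdist_le => e e0.
pose k := `|K| + 1.
have k0 : 0 < k by rewrite ltr_wpDl.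
near=> y.
have yx : `|y - x| <= Num.min 1 (e / k).
  rewrite distrC; near: y; apply: cvgr_dist_le => //.
  by rewrite lt_min ltr01 divr_gt0.
move: yx; rewrite le_min => /andP[yx1 yxe].
rewrite distrC (le_trans (fK _ yx1))//.
apply: (@le_trans _ _ (k * `|y - x|)).
  by rewrite ler_wpM2r// (le_trans (ler_norm _))// lerDl.
by rewrite mulrC -ler_pdivlMr.
Unshelve. all: by end_near. Qed.

(** For [v <= u], [exp u - exp v = exp u (1 - exp (v - u)) <= (u - v) exp u], by
    [1 + t <= exp t]. *)
Lemma expR_lipschitz_le (R : realType) (a b m : R) : a <= m -> b <= m ->
  `|expR a - expR b| <= `|a - b| * expR m.
Proof.
have H (u v : R) : v <= u -> u <= m -> expR u - expR v <= (u - v) * expR m.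
  move=> vu um; have h1 := expR_ge1Dx (v - u).
  have h2 : expR v = expR u * expR (v - u) by rewrite -expRD; congr expR; ring.
  have h3 : expR u <= expR m by rewrite ler_expR.
  have h4 := expR_ge0 u.
  rewrite h2; nra.
move=> am bm; have [ab|ba] := leP a b.
  rewrite distrC (distrC a b) ger0_norm ?subr_ge0 ?ler_expR//.
  by rewrite ger0_norm ?subr_ge0//; exact: H.
rewrite ger0_norm ?subr_ge0 ?ler_expR ?(ltW ba)//.
by rewrite ger0_norm ?subr_ge0 ?(ltW ba)//; exact: H (ltW ba) _.
Qed.

(** Multiplying [1 - u <= exp (- u)] by [exp u] bounds the remainder [exp u - 1 - u] by
    [u (exp u - 1)], which is at most [u^2 exp |u|] for either sign of [u]. *)
Lemma expR_le1DxD2 (R : realType) (u : R) :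
  expR u <= 1 + u + u ^+ 2 * expR `|u|.
Proof.
have h1 := expR_ge1Dx u; have h2 := expR_ge1Dx (- u).
have h3 : expR u * expR (- u) = 1 by rewrite -expRD subrr expR0.
have h4 := expR_gt0 u.
have h5 : expR u - 1 <= u * expR u by nra.
have [u0|u0] := leP 0 u; first by rewrite ger0_norm// expr2; nra.
have h6 : 1 <= expR `|u| by rewrite -expR0 ler_expR.
by rewrite expr2; nra.
Qed.

Section ExponentialFamily.
Context (disp : measure_display) (T : measurableType disp) (R : realType).
Context (I : finType) (mu : probability T R) (F : T -> {ffun I -> R}) (N : T -> R).
Hypothesis mF : forall i, measurable_fun setT (fun x => F x i).
Hypothesis N0 : forall x, 0 <= N x.
Hypothesis FN : forall x i, `|F x i| <= N x.
Hypothesis expN : forall a,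
  mu.-integrable setT (EFin \o (fun x => expR (a * N x))).

Local Notation l1 theta := (\sum_i `|(theta : {ffun I -> R}) i|).
Local Notation Z theta := (\int[mu]_x expR (- dot theta (F x))).

Lemma ler_norm_dot (theta y : {ffun I -> R}) (K : R) :
  (forall i, `|y i| <= K) -> `|dot theta y| <= l1 theta * K.
Proof.
move=> yK; rewrite /dot (le_trans (ler_norm_sum _ _ _))// mulr_suml.
by apply: ler_sum => i _; rewrite normrM ler_wpM2l.
Qed.

Lemma l1_ge0 (theta : {ffun I -> R}) : 0 <= l1 theta.
Proof. by apply: sumr_ge0. Qed.

Lemma measurable_dot theta : measurable_fun setT (fun x => dot theta (F x)).
Proof.
rewrite /dot; apply: measurable_sum => i.
by apply: measurable_funM => //.
Qed.

Lemma measurable_expdot theta :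
  measurable_fun setT (fun x => expR (- dot theta (F x))).
Proof.
apply: measurableT_comp => //; apply: measurableT_comp => //.
exact: measurable_dot.
Qed.

Lemma integrable_exp_bounded (k : T -> R) (a : R) : measurable_fun setT k ->
  (forall x, `|k x| <= expR (a * N x)) -> mu.-integrable setT (EFin \o k).
Proof.
move=> mk ka; apply: (le_integrable measurableT _ _ (expN a)).
  exact/measurable_EFinP.
by move=> x _ /=; rewrite lee_fin (le_trans (ka x))// ler_norm.
Qed.

Lemma expdot_le (theta : {ffun I -> R}) (r : R) x : l1 theta <= r ->
  expR (- dot theta (F x)) <= expR (r * N x).
Proof.
move=> tr; rewrite ler_expR.
have h1 := ler_norm_dot theta (FN x).
have h2 : l1 theta * N x <= r * N x by rewrite ler_wpM2r.
have h3 : - dot theta (F x) <= `|dot theta (F x)| by rewrite -normrN ler_norm.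
lra.
Qed.

Lemma integrable_expdot theta :
  mu.-integrable setT (EFin \o (fun x => expR (- dot theta (F x)))).
Proof.
apply: (@integrable_exp_bounded _ (l1 theta)); first exact: measurable_expdot.
by move=> x; rewrite ger0_norm ?expR_ge0// expdot_le.
Qed.

(** A factor bounded by [N] costs one unit of exponential rate, since [N <= 1 + N <= exp N]. *)
Lemma integrable_mul_expdot (k : T -> R) theta : measurable_fun setT k ->
  (forall x, `|k x| <= N x) ->
  mu.-integrable setT (EFin \o (fun x => k x * expR (- dot theta (F x)))).
Proof.
move=> mk kN; apply: (@integrable_exp_bounded _ (1 + l1 theta)).
  by apply: measurable_funM => //; exact: measurable_expdot.
move=> x; rewrite mulrDl mul1r expRD normrM ler_pM//.
  by rewrite (le_trans (kN x))// (le_trans _ (expR_ge1Dx _))// lerDr.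
by rewrite ger0_norm ?expR_ge0// expdot_le.
Qed.

(** A zero integral would make the positive integrand vanish almost everywhere on a space of mass
    one. *)
Lemma partition_gt0 theta : 0 < Z theta.
Proof.
have iZ := integrable_expdot theta.
rewrite lt_neqAle Rintegral_ge0 ?andbT; last by move=> x _; exact: expR_ge0.
apply/negP => /eqP Z0.
have fZ : (\int[mu]_x (expR (- dot theta (F x)))%:E = 0)%E.
  rewrite -[LHS]fineK; first by rewrite -/(Rintegral _ _ _) -Z0.
  exact: integrable_fin_num.
have /(ae_eq_integral_abs mu measurableT) : (\int[mu]_x `|(expR (- dot theta (F x)))%:E| = 0)%E.
  by rewrite -fZ; apply: eq_integral => x _ /=; rewrite ger0_norm ?expR_ge0.
move=> /(_ _)[|A [mA A0 sA]].
  by apply/measurable_EFinP; exact: measurable_expdot.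
have : (mu setT <= mu A)%E.
  apply: le_measure; rewrite ?inE//.
  move=> x _; apply: sA => /= /(_ Logic.I) [] /eqP.
  by rewrite gt_eqF// expR_gt0.
by rewrite A0 probability_setT leNgt lte01.
Qed.

Lemma dotB (theta theta' y : {ffun I -> R}) :
  dot (theta - theta') y = dot theta y - dot theta' y.
Proof.
rewrite /dot -sumrB; apply: eq_bigr => i _.
by rewrite !ffunE mulrBl.
Qed.

(** On the l1 ball of radius [r] both exponents are at most [r N], so the integrands differ by at
    most the l1 distance times [N exp (r N)]; [N <= exp N] gives the rate [1 + r]. *)
Lemma partition_lipschitz r theta theta' : l1 theta <= r -> l1 theta' <= r ->
  `|Z theta - Z theta'| <= l1 (theta - theta') * \int[mu]_x expR ((1 + r) * N x).
Proof.
move=> tr t'r.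
rewrite -RintegralB//; [|exact: integrable_expdot..].
have iB : mu.-integrable setT (EFin \o
    (fun x => expR (- dot theta (F x)) - expR (- dot theta' (F x)))).
  have := integrableB measurableT (integrable_expdot theta) (integrable_expdot theta').
  by apply: eq_integrable => // x _.
rewrite (le_trans (le_normr_Rintegral measurableT iB))//.
rewrite -RintegralZl//.
apply: le_Rintegral => //.
- exact: integrable_norm.
- exact: integrableZl (expN _).
move=> x _.
have h1 : `|expR (- dot theta (F x)) - expR (- dot theta' (F x))| <=
   `|dot (theta - theta') (F x)| * expR (r * N x).
  have -> : dot (theta - theta') (F x) = - (- dot theta (F x) - - dot theta' (F x)).
    by rewrite dotB; ring.
  rewrite normrN; apply: expR_lipschitz_le.
    by rewrite -ler_expR expdot_le.
  by rewrite -ler_expR expdot_le.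
have h2 := ler_norm_dot (theta - theta') (FN x).
apply: (le_trans h1).
rewrite mulrDl mul1r expRD mulrA ler_wpM2r ?expR_ge0//.
apply: (le_trans h2); rewrite ler_wpM2l ?l1_ge0//.
by rewrite (le_trans _ (expR_ge1Dx _))// lerDr.
Qed.

(** Instead of differentiating under the integral, coordinate [i] is moved by [t]: the new value of
    [Z] is at most [Z theta - t G + t^2 D]. Minimality gives [t G <= t^2 D] for [|t| <= 1], which
    forces [G = 0]. *)
Lemma partition_stationary theta :
  (forall theta', Z theta <= Z theta') ->
  forall i, \int[mu]_x (F x i * expR (- dot theta (F x))) = 0.
Proof.
move=> Zmin i; set G := Rintegral _ _ _.
(* The rate adds 2 from [F^2 <= exp (2 N)], 1 from [exp |t F| <= exp N], and [l1 theta] from the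
   unperturbed weight. *)
pose D := \int[mu]_x (expR ((2 + 1 + l1 theta) * N x)).
have iF : mu.-integrable setT (EFin \o (fun x => F x i * expR (- dot theta (F x)))).
  exact: integrable_mul_expdot.
have key (t : R) : `|t| <= 1 -> t * G <= t ^+ 2 * D.
  move=> t1.
  pose theta' := [ffun j => theta j + t * (j == i)%:R] : {ffun I -> R}.
  have dE x : dot theta' (F x) = dot theta (F x) + t * F x i.
    rewrite /dot; under eq_bigr do rewrite ffunE mulrDl.
    rewrite big_split/=; congr (_ + _).
    rewrite (bigD1 i)//= eqxx mulr1 big1 ?addr0// => j /negbTE ->.
    by rewrite mulr0 mul0r.
  have iL := integrable_expdot theta.
  have : Z theta' <= \int[mu]_x (expR (- dot theta (F x)) +
      ((- t) * (F x i * expR (- dot theta (F x))) +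
       t ^+ 2 * expR ((2 + 1 + l1 theta) * N x))).
    apply: le_Rintegral => //.
    - exact: integrable_expdot.
    - have i1 := integrableZl measurableT (- t) iF.
      have i2 := integrableZl measurableT (t ^+ 2) (expN (2 + 1 + l1 theta)).
      have := integrableD measurableT iL (integrableD measurableT i1 i2).
      by apply: eq_integrable => // x _.
    move=> x _; rewrite dE opprD expRD.
    have h1 := expR_le1DxD2 (- (t * F x i)).
    have h2 : `|- (t * F x i)| <= N x.
      rewrite normrN normrM (le_trans _ (FN x i))//.
      by rewrite ler_piMl.
    have h3 : expR `|- (t * F x i)| <= expR (N x) by rewrite ler_expR.
    have h4 : F x i ^+ 2 <= expR (2 * N x).
      rewrite expRM_natl.
      rewrite -real_normK ?num_real//; rewrite lerXn2r ?nnegrE ?expR_ge0//.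
      by rewrite (le_trans (FN x i))// (le_trans _ (expR_ge1Dx _))// lerDr.
    have h5 := @expdot_le theta _ x (lexx _).
    have h6 : (- (t * F x i)) ^+ 2 * expR `|- (t * F x i)| <=
        t ^+ 2 * (expR (2 * N x) * expR (N x)).
      rewrite sqrrN exprMn -mulrA ler_wpM2l ?sqr_ge0//.
      by rewrite ler_pM ?sqr_ge0 ?expR_ge0.
    have h7 := expR_ge0 (- dot theta (F x)).
    rewrite mulrDl expRD mulrDl mul1r expRD.
    apply: (@le_trans _ _ (expR (- dot theta (F x)) * (1 + - (t * F x i) +
        t ^+ 2 * (expR (2 * N x) * expR (N x))))).
      by rewrite ler_wpM2l//; lra.
    have h8 : expR (- dot theta (F x)) * (t ^+ 2 * (expR (2 * N x) * expR (N x))) <=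
       t ^+ 2 * (expR (2 * N x) * expR (N x) * expR (l1 theta * N x)).
      rewrite mulrCA ler_wpM2l ?sqr_ge0// mulrC ler_wpM2l//.
    by rewrite mulrDr; lra.
  have i1 := integrableZl measurableT (- t) iF.
  have i2 := integrableZl measurableT (t ^+ 2) (expN (2 + 1 + l1 theta)).
  rewrite RintegralD//; last first.
    by have := integrableD measurableT i1 i2; apply: eq_integrable => // x _.
  rewrite RintegralD// !RintegralZl// -/G -/D.
  have := Zmin theta'; lra.
have D0 : 0 <= D by apply: Rintegral_ge0 => x _; exact: expR_ge0.
have D1 : 0 < D + 1 by rewrite ltr_wpDl.
apply/eqP; rewrite -normr_le0 leNgt; apply/negP => G0.
(* For [t] of size [m] and of the sign of [G], the quadratic bound reads [|G| <= m D], against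
   [m (D + 1) <= |G|]. *)
pose m := Num.min 1 (`|G| / (D + 1)).
have m0 : 0 < m by rewrite lt_min ltr01 divr_gt0.
have m1 : m <= 1 by rewrite ge_min lexx.
have m2 : m * (D + 1) <= `|G| by rewrite -ler_pdivlMr// ge_min lexx orbT.
pose t := m * Num.sg G.
have G1 : G != 0 by rewrite -normr_gt0.
have t1 : `|t| <= 1 by rewrite normrM normr_sg G1 mulr1 gtr0_norm.
have tG : t * G = m * `|G| by rewrite /t -mulrA -normrEsg.
have t2 : t ^+ 2 = m ^+ 2 by rewrite exprMn sqr_sg G1 mulr1.
have := key _ t1; rewrite tG t2 expr2 -mulrA ler_pM2l//.
nra.
Qed.

Lemma partition_minimum (m c : R) : 0 < m -> 0 < c ->
  (forall (theta : {ffun I -> R}) i, m * expR (c * `|theta i|) <= Z theta) ->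
  exists theta : {ffun I -> R}, forall theta', Z theta <= Z theta'.
Proof.
move=> m0 c0 coercive.
(* Parameters are carried to row vectors, where boxes are compact and the extreme value theorem
   applies. *)
pose th (v : 'rV[R]_#|I|) : {ffun I -> R} := [ffun i => v 0 (enum_rank i)].
have th_norm v w : l1 (th v - th w) <= #|I|%:R * `|v - w|.
  rewrite mulr_natl -sumr_const; apply: ler_sum => i _.
  rewrite !ffunE.
  have -> : v 0 (enum_rank i) - w 0 (enum_rank i) = (v - w) 0 (enum_rank i).
    by rewrite !mxE.
  by rewrite [leRHS]/Num.norm/= mx_normrE; apply: (le_bigmax _ _ (0, enum_rank i)).
have cZ : continuous (fun v => Z (th v)).
  move=> v; apply: lipschitz_at_continuous.
  (* The unit sup-norm ball around [v] is mapped into the l1 ball of radius [r], where [Z] is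
     Lipschitz. *)
  pose r := l1 (th v) + #|I|%:R.
  exists (#|I|%:R * \int[mu]_x expR ((1 + r) * N x)) => w wv.
  have wr : l1 (th w) <= r.
    apply: (@le_trans _ _ (l1 (th v) + l1 (th w - th v))).
      rewrite -big_split/=; apply: ler_sum => i _.
      have -> : th w i = th v i + (th w - th v) i by rewrite !ffunE; ring.
      exact: ler_normD.
    rewrite lerD2l (le_trans (th_norm _ _))//.
    by rewrite ler_piMr.
  have vr : l1 (th v) <= r by rewrite lerDl.
  rewrite (le_trans (partition_lipschitz wr vr))// mulrAC ler_wpM2r//.
  by apply: Rintegral_ge0 => x _; exact: expR_ge0.
(* As [c B = 1/m], outside the box some coordinate yields [Z >= m (1 + 1/m) >= 1 = Z 0]; the box
   contains 0, so its minimum is global. *)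
pose B := m^-1 / c.
have B0 : 0 <= B by rewrite divr_ge0 ?invr_ge0 ?ltW.
pose A := [set v : 'rV[R]_#|I| | forall i, v ord0 i \in `[- B, B] ].
have cA : compact A.
  apply: (@rV_compact _ _ (fun=> `[(- B), B]%classic)).
  by move=> _; exact: segment_compact.
have A0 : A 0 by move=> i; rewrite mxE in_itv/= oppr_le0 B0.
have [v vA vmin] := EVT_min_rV (ex_intro _ _ A0) cA (continuous_subspaceT cZ).
have Z0 : Z 0 = 1.
  rewrite -[RHS]/(fine 1%:E) -(integral_cst_probability mu 1).
  apply: eq_Rintegral => x _; rewrite /dot big1 ?oppr0 ?expR0// => i _.
  by rewrite ffunE mul0r.
exists (th v) => theta.
pose w : 'rV[R]_#|I| := \row_j theta (enum_val j).
have wE : th w = theta by apply/ffunP => i; rewrite !ffunE mxE enum_rankK.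
have [wA|/existsNP[j wj]] := pselect (A w).
  by have := vmin w; rewrite wE; apply; exact/mem_set.
apply: (@le_trans _ _ (Z 0)).
  have := vmin 0; have -> : th 0 = 0 by apply/ffunP => i; rewrite !ffunE mxE.
  by apply; exact/mem_set.
rewrite Z0 (le_trans _ (coercive theta (enum_val j)))//.
move: wj; rewrite mxE in_itv/= -ler_norml => /negP; rewrite -ltNge => Bj.
have : m^-1 <= c * `|theta (enum_val j)|.
  by rewrite mulrC -ler_pdivrMr// ltW.
move=> h; have h2 := expR_ge1Dx (c * `|theta (enum_val j)|).
have h3 : m * m^-1 = 1 by rewrite mulfV// gt_eqF.
nra.
Qed.

End ExponentialFamily.

(** * The Gibbs variational principle *)

(** This is the Fenchel-Young inequality for [p ln p - p] and [exp]: for [p > 0], factor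
    [exp s = p exp (s - ln p)] and use [1 + t <= exp t]; at [p = 0] only [exp s] remains. *)
Lemma relative_entropy_ge0 (R : realType) (p s : R) : 0 <= p ->
  0 <= p * ln p - p * s - p + expR s.
Proof.
rewrite le_eqVlt => /predU1P[<-|p0].
  by rewrite !mul0r !subr0 add0r expR_ge0.
have h := expR_ge1Dx (s - ln p).
have -> : expR s = p * expR (s - ln p).
  by rewrite -{1}(lnK p0) -expRD; congr expR; ring.
nra.
Qed.

(** The bound [1 + t < exp t] is strict for nonzero [t], so equality with [p > 0] requires
    [s = ln p]; at [p = 0] the hypothesis already reads [exp s = 0]. *)
Lemma relative_entropy_eq0 (R : realType) (p s : R) : 0 <= p ->
  p * ln p - p * s - p + expR s = 0 -> p = expR s.
Proof.
rewrite le_eqVlt => /predU1P[<-|p0].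
  by rewrite !mul0r !subr0 add0r => /esym.
have [|/expR_gt1Dx h] := eqVneq (s - ln p) 0.
  by move=> /eqP; rewrite subr_eq0 => /eqP ->; rewrite lnK.
have -> : expR s = p * expR (s - ln p).
  by rewrite -{1}(lnK p0) -expRD; congr expR; ring.
nra.
Qed.

Section VariationalPrinciple.
Context (disp : measure_display) (T : measurableType disp) (R : realType).
Context (I : finType) (mu : probability T R) (F : T -> {ffun I -> R}) (N : T -> R).
Hypothesis mF : forall i, measurable_fun setT (fun x => F x i).
Hypothesis N0 : forall x, 0 <= N x.
Hypothesis FN : forall x i, `|F x i| <= N x.
Hypothesis expN : forall a,
  mu.-integrable setT (EFin \o (fun x => expR (a * N x))).

Section FixedParameter.
Variable theta : {ffun I -> R}.

Local Notation h := (fun x => dot theta (F x)).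
Local Notation Z := (\int[mu]_x expR (- h x)).
Local Notation L := (ln Z).
Local Notation g := (fun x => expR (- h x - L)).

Let Z0 : 0 < Z. Proof. exact: partition_gt0 mF N0 FN expN _. Qed.

Lemma gibbsE x : g x = expR (- h x) / Z.
Proof. by rewrite /= expRD [expR (- ln _)]expRN lnK ?posrE. Qed.

Lemma measurable_gibbs : measurable_fun setT g.
Proof.
apply: measurableT_comp => //; apply: measurable_funB => //.
by apply: measurableT_comp => //; exact: measurable_dot.
Qed.

Lemma integrable_gibbs : mu.-integrable setT (EFin \o g).
Proof.
have := integrableZl measurableT Z^-1 (integrable_expdot mF N0 FN expN theta).
by apply: eq_integrable => // x _; rewrite /= gibbsE mulrC.
Qed.

Lemma integral_gibbs : (\int[mu]_x (g x)%:E = 1)%E.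
Proof.
have iE := integrable_expdot mF N0 FN expN theta.
have -> : (\int[mu]_x (g x)%:E = \int[mu]_x (Z^-1%:E * (expR (- h x))%:E))%E.
  by apply: eq_integral => x _; rewrite gibbsE mulrC EFinM.
rewrite integralZl// -[X in (_ * X)%E]fineK; last exact: integrable_fin_num.
by rewrite -EFinM mulVf// gt_eqF.
Qed.

Lemma integrable_dot (nu : probability T R) :
  (forall i, nu.-integrable setT (EFin \o (fun x => F x i))) ->
  nu.-integrable setT (EFin \o h).
Proof.
move=> iF.
have : nu.-integrable setT
    (fun x => \sum_(i <- index_enum I) (theta i)%:E * (F x i)%:E)%E.
  by apply: integrable_sum => // i _; exact: (integrableZl measurableT _ (iF i)).
apply: eq_integrable => // x _ /=.
by rewrite /dot -sumEFin; apply: eq_bigr => i _; rewrite EFinM.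
Qed.

Lemma Rintegral_dot (nu : probability T R) :
  (forall i, nu.-integrable setT (EFin \o (fun x => F x i))) ->
  \int[nu]_x h x = dot theta [ffun i => \int[nu]_x F x i].
Proof.
move=> iF; rewrite /Rintegral.
have -> : (\int[nu]_x (h x)%:E =
    \sum_(i <- index_enum I) \int[nu]_x ((theta i)%:E * (F x i)%:E))%E.
  rewrite -integral_sum//; last first.
    by move=> i; exact: (integrableZl measurableT _ (iF i)).
  apply: eq_integral => x _ /=.
  by rewrite /dot -sumEFin; apply: eq_bigr => i _; rewrite EFinM.
rewrite -sum_fine; last first.
  move=> i _; apply: integrable_fin_num => //.
  exact: (integrableZl measurableT _ (iF i)).
rewrite /dot; apply: eq_bigr => i _; rewrite ffunE.
rewrite (integralZl measurableT (iF i)) fineM//.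
exact: (integrable_fin_num measurableT (iF i)).
Qed.

Section Gap.
Variables (nu : probability T R) (p : T -> R).
Hypothesis numu : nu `<< mu.
Hypothesis mp : measurable_fun setT p.
Hypothesis p0 : forall x, 0 <= p x.
Hypothesis dp : {ae mu, forall x, density nu mu x = (p x)%:E}.
Hypothesis ih : nu.-integrable setT (EFin \o h).

(** The pointwise Fenchel-Young gap at [s = - h x - L], the logarithm of the Gibbs density [g]. *)
Let u x := p x * ln (p x) - p x * (- h x - L) - p x + g x.

Let u0 x : 0 <= u x.
Proof. exact: relative_entropy_ge0. Qed.

Let mh : measurable_fun setT h.
Proof. exact: measurable_dot. Qed.

Let meas_u : measurable_fun setT u.
Proof.
apply: measurable_funD; last exact: measurable_gibbs.
apply: measurable_funB => //; apply: measurable_funB.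
  by apply: measurable_funM => //; exact: measurableT_comp.
apply: measurable_funM => //; apply: measurable_funB => //.
exact: measurableT_comp.
Qed.

(** Writing [p ln p = u + (k p - g)] separates a nonnegative gap from a [mu]-integrable term, which
    is legitimate even when the entropy is infinite. *)
Lemma KL_gap : (KL nu mu = \int[mu]_x (u x)%:E - (\int[nu]_x h x + L)%:E)%E.
Proof.
(* This is [s + 1]: [s] comes from the cross term and 1 from [- p]; the 1 finally cancels against
   the total mass of [g]. *)
pose k x := - h x - L + 1.
have ik : nu.-integrable setT (EFin \o k).
  have i1 := integrableN ih.
  have i2 : nu.-integrable setT (EFin \o cst (1 - L)).
    exact: finite_measure_integrable_cst.
  have := integrableD measurableT i1 i2.
  by apply: eq_integrable => // x _; rewrite /k /= -?EFinN -?EFinD; congr EFin; ring.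
have mk : measurable_fun setT k by apply/measurable_EFinP; exact: measurable_int ik.
have ikp : mu.-integrable setT (fun x => (k x * p x)%:E).
  exact/(integrable_density numu mp p0 dp).
rewrite (KL_density numu mp dp).
have iw : mu.-integrable setT (EFin \o (fun x => k x * p x - g x)).
  have := integrableB measurableT ikp integrable_gibbs.
  by apply: eq_integrable => // x _.
have -> : (\int[mu]_x (p x * ln (p x))%:E =
  \int[mu]_x (u x + (k x * p x - g x))%:E)%E.
  by apply: eq_integral => x _; congr EFin; rewrite /u /k; ring.
rewrite integralD_ge0_integrable//; congr (_ + _)%E.
have -> : (\int[mu]_x (k x * p x - g x)%:E =
   \int[mu]_x (k x * p x)%:E - \int[mu]_x (g x)%:E)%E.
  rewrite -integralB//; last exact: integrable_gibbs.
rewrite integral_gibbs -(integral_density numu mp dp ik).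
have -> : (\int[nu]_x (k x)%:E = (- (\int[nu]_x h x) - L + 1)%:E)%E.
  have i1 := integrableN ih.
  have i2 : nu.-integrable setT (EFin \o cst (1 - L)).
    exact: finite_measure_integrable_cst.
  have -> : (\int[nu]_x (k x)%:E = \int[nu]_x ((- (h x)%:E) + (cst (1 - L) x)%:E))%E.
    by apply: eq_integral => x _; rewrite /k /= -?EFinN -?EFinD; congr EFin; ring.
  rewrite (integralD measurableT i1 i2).
  have -> : (\int[nu]_x (EFin \o cst (1 - L)%R) x = (1 - L)%R%:E)%E.
    exact: integral_cst_probability.
  have -> : (\int[nu]_x (-%E \o (EFin \o h)) x = - \int[nu]_x (h x)%:E)%E.
    by rewrite -integralN ?integrable_add_def.
  rewrite -[X in (- X + _)%E]fineK; last exact: integrable_fin_num ih.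
  by rewrite -EFinN -EFinD; congr EFin; rewrite /Rintegral; ring.
rewrite -EFinB -?EFinN; congr EFin; ring.
Qed.

Lemma KL_gap_ge0 : (- (\int[nu]_x h x + L)%:E <= KL nu mu)%E.
Proof.
rewrite KL_gap leeDr//.
by apply: integral_ge0 => x _; rewrite lee_fin.
Qed.

(** The nonnegative gap then has zero integral, so it vanishes almost everywhere, and the equality
    case gives [p = g] there. *)
Lemma KL_gap_eq0 : KL nu mu = (- (\int[nu]_x h x + L)%:E)%E ->
  forall A, measurable A -> nu A = (\int[mu]_(x in A) (g x)%:E)%E.
Proof.
rewrite KL_gap => gap0 A mA.
have u_0 : (\int[mu]_x (u x)%:E = 0)%E.
  rewrite -[LHS](@subeK _ _ (\int[nu]_x h x + L)%:E)// gap0.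
  by rewrite -EFinN -EFinD addNr.
have : (\int[mu]_x `|(u x)%:E| = 0)%E.
  by rewrite -u_0; apply: eq_integral => x _; rewrite /= ger0_norm.
move=> /(ae_eq_integral_abs mu measurableT) => /(_ _)[|B [mB B0 sB]].
  exact/measurable_EFinP.
rewrite (density_measure numu mp dp mA).
apply: ae_eq_integral => //.
- by apply: measurable_funTS; exact/measurable_EFinP.
- by apply: measurable_funTS; apply/measurable_EFinP; exact: measurable_gibbs.
exists B; split => // x /= pg; apply: sB => /= ux; apply: pg => _.
congr EFin; apply: relative_entropy_eq0 => //.
by have [] := ux Logic.I.
Qed.

End Gap.

(** With [p = g] the gap integrand vanishes identically. *)
Lemma KL_gibbs (nu : probability T R) :
  (forall A, measurable A -> nu A = (\int[mu]_(x in A) (g x)%:E)%E) ->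
  nu.-integrable setT (EFin \o h) ->
  KL nu mu = (- (\int[nu]_x h x + L)%:E)%E.
Proof.
move=> nug ih; have g0 x : 0 <= g x by exact: expR_ge0.
have [numu dg] := density_unique measurable_gibbs g0 nug.
rewrite (KL_gap numu measurable_gibbs g0 dg ih).
rewrite (_ : (\int[mu]_x _ = 0)%E) ?add0e//.
by apply: integral0_eq => x _; rewrite expRK; congr EFin; ring.
Qed.

End FixedParameter.
End VariationalPrinciple.

(** * Maximum entropy on R^d *)

Lemma continuous_borelRn_measurable (R : realType) (d : nat) (f : 'cV[R]_d -> R) :
  continuous f -> measurable_fun setT (f : borelRn R d -> R).
Proof.
move=> /continuousP cf; apply: (measurability _ (RGenOpens.measurableE R)).
move=> _ [_ [a [b ->] <-]]; rewrite setTI.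
by apply: sub_sigma_algebra; apply: cf; exact: interval_open.
Qed.

Lemma ler_norm_entry (R : realType) (m n : nat) (A : 'M[R]_(m, n)) i j :
  `|A i j| <= `|A|.
Proof. by rewrite [leRHS]/Num.norm/= mx_normrE; apply: (le_bigmax _ _ (i, j)). Qed.

Lemma mulmx_entry_bound (R : realType) (m n : nat) (A : 'M[R]_(m, n))
    (y : 'cV[R]_n) (K : R) i :
  (forall l, `|y l 0| <= K) -> `|(A *m y) i 0| <= (\sum_l `|A i l|) * K.
Proof.
move=> yK; rewrite mxE (le_trans (ler_norm_sum _ _ _))// mulr_suml.
by apply: ler_sum => l _; rewrite normrM ler_wpM2l.
Qed.

(** * The Euclidean norm and its exponential moments *)

Section EuclideanNorm.
Context (R : realType) (d : nat).
Implicit Type x : 'cV[R]_d.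

Lemma enorm_ge0 x : 0 <= enorm x.
Proof. exact: sqrtr_ge0. Qed.

(** Here [|x|] is the sup norm; the comparison turns Lipschitz bounds in that norm into growth
    bounds in the Euclidean one. *)
Lemma ler_norm_enorm x : `|x| <= enorm x.
Proof.
rewrite [leLHS]/Num.norm/= mx_normrE; apply/bigmax_leP; split => [|[i j] _ /=].
  exact: enorm_ge0.
rewrite (ord1 j) -sqrtr_sqr ler_wsqrtr// (bigD1 i)//= lerDl.
by apply: sumr_ge0 => k _; exact: sqr_ge0.
Qed.

Lemma measurable_enorm : measurable_fun setT (@enorm R d : borelRn R d -> R).
Proof.
rewrite /enorm; apply: measurableT_comp.
  by apply: continuous_measurable_fun; exact: sqrt_continuous.
apply: measurable_sum => i; apply: measurable_funX.
by apply: continuous_borelRn_measurable; exact: coord_continuous.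
Qed.

End EuclideanNorm.

(** Past the threshold [T], where [eta T^(alpha - 1) = |a|], the superlinear power dominates; up to
    it, the constant [|a| T] suffices. *)
Lemma linear_le_powR (R : realType) (alpha eta a : R) : 1 < alpha -> 0 < eta ->
  exists K, forall t, 0 <= t -> a * t <= K + eta * t `^ alpha.
Proof.
move=> alpha1 eta0.
have alpha10 : 0 < alpha - 1 by rewrite subr_gt0.
pose T := (`|a| / eta) `^ (alpha - 1)^-1.
have T0 : 0 <= T by exact: powR_ge0.
exists (`|a| * T) => t t0.
have at_le : a * t <= `|a| * t by rewrite ler_wpM2r// ler_norm.
have pow0 : 0 <= eta * t `^ alpha by rewrite mulr_ge0 ?powR_ge0 ?ltW.
have [tT|Tt] := leP t T.
  have : `|a| * t <= `|a| * T by rewrite ler_wpM2l.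
  lra.
have t_gt0 : 0 < t by exact: le_lt_trans Tt.
have aT : 0 <= `|a| * T by rewrite mulr_ge0.
suff : `|a| * t <= eta * t `^ alpha by lra.
have -> : t `^ alpha = t `^ (alpha - 1) * t.
  rewrite -[in X in _ * X](powRr1 t0) -powRD; first by congr (_ `^ _); ring.
  by apply/implyP => _; rewrite gt_eqF.
rewrite mulrA ler_wpM2r//.
have -> : `|a| = eta * T `^ (alpha - 1).
  rewrite -powRrM mulVf ?gt_eqF// powRr1 ?divr_ge0 ?(ltW eta0)//.
  by rewrite mulrC divfK// gt_eqF.
by rewrite ler_wpM2l ?(ltW eta0)// ge0_ler_powR ?nnegrE// ltW.
Qed.

Lemma exp_enorm_integrable (R : realType) (d : nat)
    (mu : probability (borelRn R d) R) :
  (exists alpha eta : R, [/\ 1 < alpha, 0 < eta &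
     (\int[mu]_x (expR (eta * enorm x `^ alpha))%:E < +oo)%E]) ->
  forall a, mu.-integrable setT (fun x : borelRn R d => (expR (a * enorm x))%:E).
Proof.
move=> [alpha [eta [alpha1 eta0 fin]]] a.
have [K aK] := linear_le_powR a alpha1 eta0.
have mpow : measurable_fun setT
    (fun x : borelRn R d => expR (eta * enorm x `^ alpha)).
  apply: measurableT_comp => //; apply: measurable_funM => //.
  exact: (measurableT_comp (measurable_powR alpha) (@measurable_enorm R d)).
have ie : mu.-integrable setT
    (fun x : borelRn R d => (expR (eta * enorm x `^ alpha))%:E).
  apply/integrableP; split; first exact/measurable_EFinP.
  by under eq_integral do rewrite /= ger0_norm ?expR_ge0//.
apply: (le_integrable measurableT _ _ (integrableZl measurableT (expR K) ie)).
  apply/measurable_EFinP; apply: measurableT_comp => //.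
  by apply: measurable_funM => //; exact: measurable_enorm.
move=> x _; rewrite -EFinM -expRD /= lee_fin !ger0_norm ?expR_ge0// ler_expR.
exact/aK/enorm_ge0.
Qed.

(** * Duality for features of linear growth *)

Section MaximumEntropyDuality.
Context (R : realType) (d : nat) (I : finType).
Context (mu : probability (borelRn R d) R) (F : 'cV[R]_d -> {ffun I -> R}) (C : R).
Hypothesis mF : forall i, measurable_fun setT (fun x : borelRn R d => F x i).
Hypothesis C1 : 1 <= C.
Hypothesis FC : forall x i, `|F x i| <= C * (1 + enorm x).
Hypothesis exp_enorm : forall a,
  mu.-integrable setT (fun x : borelRn R d => (expR (a * enorm x))%:E).

(** One bound serves the features and, as [1 <= C], the norm itself; the latter gives Gibbs measures
    a finite first moment. *)
Let N (x : borelRn R d) := C * (1 + enorm x).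

Let N0 x : 0 <= N x.
Proof. by rewrite mulr_ge0 ?addr_ge0 ?enorm_ge0// (le_trans ler01). Qed.

Let FN (x : borelRn R d) i : `|F x i| <= N x.
Proof. exact: FC. Qed.

Let enormN (x : borelRn R d) : `|enorm x| <= N x.
Proof.
rewrite ger0_norm ?enorm_ge0// /N mulrDr mulr1 (le_trans (ler_peMl (enorm_ge0 x) C1))//.
by rewrite lerDr (le_trans ler01).
Qed.

Lemma exp_growth_integrable a :
  mu.-integrable setT (EFin \o (fun x => expR (a * N x))).
Proof.
have := integrableZl measurableT (expR (a * C)) (exp_enorm (a * C)).
apply: eq_integrable => // x _ /=.
by rewrite -EFinM -expRD; congr (expR _)%:E; rewrite /N; ring.
Qed.

Lemma P1_integrable_feature (nu : probability (borelRn R d) R) i : P1 nu ->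
  nu.-integrable setT (fun x : borelRn R d => (F x i)%:E).
Proof.
move=> P1nu.
have ie : nu.-integrable setT (fun x : borelRn R d => (enorm x)%:E).
  apply/integrableP; split; first by apply/measurable_EFinP; exact: measurable_enorm.
  by under eq_integral do rewrite /= ger0_norm ?enorm_ge0//.
have i1 : nu.-integrable setT (EFin \o cst 1).
  exact: finite_measure_integrable_cst.
have iN := integrableZl measurableT C (integrableD measurableT i1 ie).
apply: (le_integrable measurableT _ _ iN); first exact/measurable_EFinP.
by move=> x _; rewrite /= lee_fin (le_trans (FN x i))// ler_norm.
Qed.

(** The second clause is meant for [k = enorm], giving membership in [P1], and for [k] a coordinate
    of [F], turning stationarity into the moment constraint. *)
Lemma gibbs_measure_exists theta : exists nu : probability (borelRn R d) R,
  (forall A, measurable A ->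
     nu A = \int[mu]_(x in A)
       (expR (- dot theta (F x) - log_partition mu F theta))%:E)%E /\
  (forall k : borelRn R d -> R, measurable_fun setT k ->
     (forall x, `|k x| <= N x) ->
     nu.-integrable setT (EFin \o k) /\
     \int[nu]_x k x = (\int[mu]_x expR (- dot theta (F x)))^-1 *
       \int[mu]_x (k x * expR (- dot theta (F x)))).
Proof.
have mg := measurable_gibbs mu mF theta.
have g0 (x : borelRn R d) :
  0 <= expR (- dot theta (F x) - log_partition mu F theta) by exact: expR_ge0.
have [nu nug] := probability_of_density mg g0 (integral_gibbs mF N0 FN exp_growth_integrable theta).
exists nu; split => // k mk kN.
have [numu dg] := density_unique mg g0 nug.
set Z := Rintegral _ _ (fun x => expR (- dot _ _)).
have ike := integrable_mul_expdot mF N0 FN exp_growth_integrable theta mk kN.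
have gE (x : borelRn R d) :
    expR (- dot theta (F x) - log_partition mu F theta) =
    expR (- dot theta (F x)) / Z.
  exact: (gibbsE mF N0 FN exp_growth_integrable).
have ik : nu.-integrable setT (EFin \o k).
  apply/(integrable_density numu mg g0 dg mk).
  have := integrableZl measurableT Z^-1 ike.
  apply: eq_integrable => // x _ /=.
  by rewrite -EFinM gE; congr EFin; ring.
split => //.
rewrite -RintegralZl//; congr fine; rewrite (integral_density numu mg dg ik).
by apply: eq_integral => x _; rewrite gE; congr EFin; ring.
Qed.

(** Weak duality: the gap is nonnegative when [rho] is absolutely continuous, and otherwise the
    right-hand side is infinite. *)
Lemma KL_lower_bound theta (rho : probability (borelRn R d) R) : P1 rho ->
  ((- log_partition mu F theta)%:E <=
   KL rho mu + (dot theta (feature_expectation F rho))%:E)%E.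
Proof.
move=> P1rho; have iF i := P1_integrable_feature i P1rho.
have [rhomu|/asboolPn rhomu] := pselect (rho `<< mu); last first.
  by rewrite /KL (negbTE rhomu) addye// leey.
have [p [mp p0 dp]] := density_version rhomu.
have := KL_gap_ge0 mF N0 FN exp_growth_integrable rhomu mp p0 dp (integrable_dot theta iF).
rewrite (Rintegral_dot theta iF).
case: (KL rho mu) => [r| |].
- rewrite -?EFinN -?EFinD !lee_fin /log_partition /feature_expectation; lra.
- by move=> _; rewrite addye// leey.
- by [].
Qed.

Theorem maximum_entropy_duality theta :
  (forall i, \int[mu]_x (F x i * expR (- dot theta (F x))) = 0) ->
  is_dual_solution mu F theta /\
  exists nu : probability (borelRn R d) R,
    is_gibbs mu F theta nu /\ is_the_primal_solution mu F nu.
Proof.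
move=> stationary; have [nu [nug nuk]] := gibbs_measure_exists theta.
have mg := measurable_gibbs mu mF theta.
have g0 (x : borelRn R d) :
  0 <= expR (- dot theta (F x) - log_partition mu F theta) by exact: expR_ge0.
have [numu dg] := density_unique mg g0 nug.
have dot0 theta' : dot theta' (0 : {ffun I -> R}) = 0.
  by rewrite /dot big1// => i _; rewrite ffunE mulr0.
have P1nu : P1 nu.
  have [ie _] := nuk _ (@measurable_enorm R d) enormN.
  by have := integrable_lty measurableT ie.
(* Stationarity divided by [Z] is exactly the moment constraint. *)
have fe0 : feature_expectation F nu = 0.
  apply/ffunP => i; rewrite !ffunE.
  have [_ ->] := nuk _ (mF i) (fun x => FN x i).
  by rewrite stationary mulr0.
have iF i := P1_integrable_feature i P1nu.
have KLnu : KL nu mu = (- log_partition mu F theta)%:E.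
  rewrite (KL_gibbs mF N0 FN exp_growth_integrable nug (integrable_dot theta iF)).
  rewrite (Rintegral_dot theta iF) -[finfun _]/(feature_expectation F nu) fe0.
  by rewrite dot0 add0r.
split.
  split; first exact: integrable_lty (integrable_expdot mF N0 FN exp_growth_integrable theta).
  move=> theta' _; apply: (@le_trans _ _ (- log_partition mu F theta)%:E).
    apply: ereal_inf_lbound; exists nu => //.
    by rewrite fe0 dot0 adde0.
  by apply: le_ereal_inf_tmp => _ [rho P1rho <-]; exact: KL_lower_bound.
exists nu; split => //.
have lower rho : P1F F rho -> ((- log_partition mu F theta)%:E <= KL rho mu)%E.
  move=> [P1rho ferho]; have := KL_lower_bound theta P1rho.
  by rewrite ferho dot0 adde0.
have nu_min : primal_minimizer mu F nu.
  by split => // rho P1Frho; rewrite KLnu; exact: lower.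
split => // rho [P1Frho rho_min] A mA.
(* A competing minimizer attains the same finite value; it is therefore absolutely continuous with
   zero gap at [theta], and [KL_gap_eq0] identifies it with [nu]. *)
have KLrho : KL rho mu = (- log_partition mu F theta)%:E.
  apply/eqP; rewrite eq_le lower// andbT -KLnu.
  by apply: rho_min; case: nu_min.
have rhomu : rho `<< mu.
  apply: contrapT => /asboolPn rhomu.
  by move: KLrho; rewrite /KL (negbTE rhomu).
have [P1rho ferho] := P1Frho.
have iFrho i := P1_integrable_feature i P1rho.
have [p [mp p0 dp]] := density_version rhomu.
rewrite nug//; apply: (KL_gap_eq0 mF N0 FN exp_growth_integrable rhomu mp p0 dp) => //.
  exact: integrable_dot.
rewrite (Rintegral_dot theta iFrho) -[finfun _]/(feature_expectation F rho).
by rewrite ferho dot0 add0r.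
Qed.

End MaximumEntropyDuality.

(** * Coercivity of the partition function *)

(** Coordinates along a free family are linear functionals, bounded through their values on the
    canonical basis. Summing these bounds serves every [i], and the added 1 keeps [K] positive. *)
Lemma free_coord_bound (R : realType) (d : nat) (I : finType) (v : I -> 'cV[R]_d) :
  free [seq v i | i : I] -> exists K, 0 < K /\
    forall (theta : I -> R) i,
      `|theta i| <= K * \sum_k `|(\sum_j theta j *: v j) k 0|.
Proof.
move=> v_free.
have Xn : size [seq v i | i : I] == #|I| by rewrite size_image.
pose X := Tuple Xn.
pose B i k := `|coord X (enum_rank i) (delta_mx k 0)|.
have B0 i k : 0 <= B i k by exact: normr_ge0.
have sB0 i : 0 <= \sum_k B i k by rewrite sumr_ge0.
exists (1 + \sum_i \sum_k B i k); split.
  by rewrite ltr_pwDl// sumr_ge0.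
move=> theta i; set w := \sum_j theta j *: v j.
have -> : theta i = coord X (enum_rank i) w.
  have -> : w = \sum_(l < #|I|) theta (enum_val l) *: X`_l.
    rewrite /w (reindex _ (onW_bij _ (enum_val_bij I)))/=.
    apply: eq_bigr => l _; congr (_ *: _).
    rewrite (nth_map i) -?cardE//; congr v.
    by rewrite (enum_val_nth i).
  by rewrite (coord_sum_free (fun l => theta (enum_val l)))// enum_rankK.
rewrite [in leLHS](matrix_sum_delta w) linear_sum.
rewrite (le_trans (ler_norm_sum _ _ _))// mulr_sumr.
apply: ler_sum => k _; rewrite big_ord1 linearZ normrM mulrC ler_wpM2r//.
rewrite -[leLHS]/(B i k) (le_trans _ (_ : \sum_k B i k <= _))//.
  by rewrite (bigD1 k)//= lerDl sumr_ge0.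
by rewrite (bigD1 i)//= addrCA lerDl addr_ge0// sumr_ge0.
Qed.

(* For a sign vector [s] the box around [x0 - (3r/4) s] is an open set on which
   every linear form [w] with signs [s] is at most [- (r/2) |w|_1]; finitely many
   boxes serve all parameters. *)
Lemma partition_coercive (R : realType) (d : nat) (I : finType)
    (mu : probability (borelRn R d) R) (F : 'cV[R]_d -> {ffun I -> R})
    (x0 : 'cV[R]_d) (v : I -> 'cV[R]_d) :
  (forall A : set 'cV[R]_d, open A -> A !=set0 -> (0 < mu A)%E) ->
  (forall theta, mu.-integrable setT
     (EFin \o (fun x : borelRn R d => expR (- dot theta (F x))))) ->
  (\forall x \near x0, forall i, F x i = \sum_k v i k 0 * (x k 0 - x0 k 0)) ->
  free [seq v i | i : I] ->
  exists m c, [/\ 0 < m, 0 < c & forall (theta : {ffun I -> R}) i,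
    m * expR (c * `|theta i|) <= \int[mu]_x expR (- dot theta (F x))].
Proof.
move=> mu_open iF Faffine v_free.
have [K [K0 vK]] := free_coord_bound v_free.
have [r r0 Fr] := (nbhs_ballP _ _).1 Faffine.
pose sg (s : {ffun 'I_d -> bool}) k : R := if s k then 1 else -1.
pose y (s : {ffun 'I_d -> bool}) : 'cV[R]_d := x0 - \col_k (3 / 4 * r * sg s k).
(* Each coordinate of [x0 - x], multiplied by its sign in [s], lies strictly between [r / 2] and [r]
   on this box: large enough for the bound, small enough for [F] to be affine. *)
pose S s := ball (y s) (r / 4).
have r40 : 0 < r / 4 by rewrite divr_gt0.
have mS s : measurable (S s : set (borelRn R d)).
  by apply: sub_sigma_algebra; exact: ball_open.
have muS s : 0 < fine (mu (S s)).
  rewrite fine_gt0// mu_open//; last by exists (y s); exact: ballxx.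
    by rewrite -ge0_fin_numE// fin_num_measure.
  exact: ball_open.
pose s0 : {ffun 'I_d -> bool} := [ffun=> true].
(* The least mass among finitely many boxes is the multiplicative constant. *)
have [s1 _ s1min] := @arg_minP _ _ _ s0 xpredT (fun s => fine (mu (S s))) erefl.
(* The rate comes from [|theta i| <= K |w|_1], which turns [(r / 2) |w|_1] into a bound in
   [|theta i|]. *)
exists (fine (mu (S s1))), (r / 2 / K); split => //.
  by rewrite !divr_gt0.
(* Near [x0], [dot theta (F x)] is the linear form [w] applied to [x - x0]; the signs of [w] select
   the box. *)
move=> theta i; pose w := \sum_j theta j *: v j.
pose s : {ffun 'I_d -> bool} := [ffun k => 0 <= w k 0].
have sgw k : sg s k * w k 0 = `|w k 0|.
  rewrite /sg ffunE; case: ifPn => [/ger0_norm -> |]; first by rewrite mul1r.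
  by rewrite -ltNge => /ltr0_norm ->; rewrite mulN1r.
have dotS x : S s x -> - dot theta (F x) >= r / 2 / K * `|theta i|.
  move=> [_ Sx].
  have xx0 k : 0 < sg s k * (x0 k 0 - x k 0) - r / 2 /\
      `|x0 k 0 - x k 0| < r.
    have := Sx k 0; rewrite /ball/= !mxE /sg.
    by case: ifP => _; rewrite !ltr_norml => /andP[h1 h2]; split; try lra;
      apply/andP; split; lra.
  have -> : dot theta (F x) = \sum_k w k 0 * (x k 0 - x0 k 0).
    rewrite /dot; under eq_bigr => j _.
      rewrite Fr; last first.
        split => // k l; rewrite (ord1 l); have [_] := xx0 k; exact.
      rewrite mulr_sumr; over.
    rewrite exchange_big/=; apply: eq_bigr => k _.
    rewrite /w summxE mulr_suml; apply: eq_bigr => j _.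
    by rewrite mxE mulrA.
  apply: (@le_trans _ _ (r / 2 * \sum_k `|w k 0|)).
    rewrite -mulrA ler_wpM2l ?divr_ge0 ?(ltW r0)//.
    by rewrite mulrC ler_pdivrMr// mulrC vK.
  rewrite mulr_sumr -sumrN; apply: ler_sum => k _.
  have [h _] := xx0 k.
  have -> : - (w k 0 * (x k 0 - x0 k 0)) = `|w k 0| * (sg s k * (x0 k 0 - x k 0)).
    rewrite -sgw; have : sg s k * sg s k = 1.
      by rewrite /sg; case: ifP => _; rewrite ?mulrNN mul1r.
    by move=> h1; rewrite -[LHS]mul1r -h1; ring.
  by rewrite mulrC ler_wpM2l//; lra.
set e := expR _.
have e0 : 0 <= e by exact: expR_ge0.
apply: (@le_trans _ _ (fine (mu (S s)) * e)).
  by rewrite ler_wpM2r//; exact: s1min.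
have mh : measurable_fun setT
    (fun x : borelRn R d => expR (- dot theta (F x))).
  by apply/measurable_EFinP; exact: measurable_int (iF theta).
rewrite -lee_fin /Rintegral [leRHS]fineK; last exact: integrable_fin_num (iF theta).
rewrite EFinM fineK ?fin_num_measure// muleC -integral_cst//.
apply: (@le_trans _ _ (\int[mu]_(x in S s) (expR (- dot theta (F x)))%:E)%E).
  apply: ge0_le_integral => //.
  - by apply: measurable_funTS; exact/measurable_EFinP.
  - by move=> x Sx; rewrite lee_fin ler_expR; exact: dotS.
apply: ge0_subset_integral => //; first exact/measurable_EFinP.
Qed.

(** * ReLU networks *)

Lemma relu_lipschitz (R : realType) (a b : R) : `|relu a - relu b| <= `|a - b|.
Proof.
have h1 := ler_norm (a - b); have h2 := ler_norm (b - a).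
rewrite distrC in h2; rewrite /relu ler_norml.
by have [ha|ha] := leP 0 a; have [hb|hb] := leP 0 b; apply/andP; split; lra.
Qed.

(** A perturbation smaller than [|a0|] preserves the sign, so [relu] stays on one linear piece. The
    slope is tested on [relu a0] because [activation_mx] reads layer outputs. *)
Lemma relu_near (R : realType) (a0 a : R) : a0 != 0 -> `|a - a0| < `|a0| ->
  relu a - relu a0 = (if 0 < relu a0 then 1 else 0) * (a - a0).
Proof.
rewrite /relu lt_max ltxx /= => a00.
have [a0p|a0n] := ltP 0 a0.
  rewrite (gtr0_norm a0p) ltr_norml => /andP[h1 h2].
  by rewrite max_r; [rewrite mul1r|lra].
have a0n' : a0 < 0 by rewrite lt_neqAle a00.
rewrite (ltr0_norm a0n') ltr_norml => /andP[h1 h2].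
by rewrite max_l; [rewrite subrr mul0r|lra].
Qed.

Section ReluNetwork.
Context (R : realType) (d : nat) (c n : nat -> nat).
Variable W : forall j (k : 'I_(c j.+1)), 'M[R]_(n j.+1, width d c n j).
Variable b : forall j (k : 'I_(c j.+1)), 'cV[R]_(n j.+1).

Local Notation out := (layer_out W b (@relu R)).

Lemma affine_layerB j (y y' : 'cV[R]_(width d c n j)) :
  affine_layer W b y - affine_layer W b y' = linear_layer W j *m (y - y').
Proof.
rewrite /affine_layer /linear_layer -mxcolB mxcol_mul.
by apply: eq_mxcol => k; rewrite /affine_channel mulmxBr opprD addrACA subrr addr0.
Qed.

Lemma layer_outS j x i :
  out j.+1 x i 0 = relu (affine_layer W b (out j x) i 0).
Proof. by rewrite /= mxE. Qed.

(** Since [relu] is 1-Lipschitz, each layer multiplies the constant by at most the sum of absolute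
    matrix entries. This serves both the growth of the features and the stability of signs near
    [x0]. *)
Lemma layer_out_lipschitz j : exists K, 0 <= K /\
  forall x y i, `|out j x i 0 - out j y i 0| <= K * `|x - y|.
Proof.
elim: j => [|j [K [K0 outK]]].
  exists 1; split => // x y i; rewrite mul1r.
  have -> : out 0 x i 0 - out 0 y i 0 = (x - y) i 0 by rewrite !mxE.
  exact: ler_norm_entry.
pose A := linear_layer W j.
pose B := \sum_i \sum_l `|A i l|.
exists (B * K); split.
  by rewrite mulr_ge0// sumr_ge0// => i _; rewrite sumr_ge0.
move=> x y i; rewrite !layer_outS (le_trans (relu_lipschitz _ _))//.
have -> : affine_layer W b (out j x) i 0 - affine_layer W b (out j y) i 0 =
    (A *m (out j x - out j y)) i 0.
  by rewrite -affine_layerB !mxE.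
rewrite (le_trans (mulmx_entry_bound (K := K * `|x - y|) _ _ _))//.
  by move=> l; rewrite !mxE.
rewrite mulrA ler_wpM2r// ler_wpM2r//.
by rewrite /B (bigD1 i)//= lerDl sumr_ge0// => l _; rewrite sumr_ge0.
Qed.

Lemma channel_mean_covector j (k : 'I_(c j.+1)) x :
  channel_mean W b (@relu R) k x = ((mean_covector R d n k)^T *m out j.+1 x) 0 0.
Proof.
have -> : out j.+1 x = \mxcol_(k' < c j.+1) channel_out W b (@relu R) k' x.
  by apply/matrixP => i l; rewrite /= !mxE.
rewrite /mean_covector tr_mxcol mul_mxrow_mxcol summxE (bigD1 k)//= big1 ?addr0.
  rewrite mxE /channel_mean mulr_sumr; apply: eq_bigr => l _.
  by rewrite !mxE eqxx.
move=> k' /negbTE kk'; rewrite mxE big1// => l _.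
by rewrite !mxE kk' mul0r.
Qed.

(** The finitely many nonzero pre-activations keep their signs near [x0], so each activation acts
    there as a diagonal 0-1 matrix on increments. Quantifying [u] inside the neighbourhood lets the
    induction hypothesis be used at another covector. *)
Lemma layer_out_near_affine M (x0 : 'cV[R]_d) :
  (forall j, (j < M)%N -> forall i : 'I_(width d c n j.+1),
     affine_layer W b (out j x0) i 0 != 0) ->
  forall j, (j <= M)%N -> \forall x \near x0, forall u : 'cV[R]_(width d c n j),
    u^T *m (out j x - out j x0) =
    (active_tr_prod W b (@relu R) x0 u)^T *m (x - x0).
Proof.
move=> pre0; elim=> [_|j IHj jM]; first by near=> x => u.
have stable : \forall x \near x0, forall i : 'I_(width d c n j.+1),
    `|affine_layer W b (out j x) i 0 - affine_layer W b (out j x0) i 0| <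
    `|affine_layer W b (out j x0) i 0|.
  apply: (@filter_forall _ 'I_(width d c n j.+1) _ (nbhs x0) _) => i.
  have cont : {for x0, continuous (fun x => affine_layer W b (out j x) i 0)}.
    have [K [K0 outK]] := layer_out_lipschitz j.
    apply: lipschitz_at_continuous; exists ((\sum_l `|linear_layer W j i l|) * K).
    move=> x _.
    have -> : affine_layer W b (out j x) i 0 - affine_layer W b (out j x0) i 0 =
        (linear_layer W j *m (out j x - out j x0)) i 0.
      by rewrite -affine_layerB !mxE.
    rewrite -mulrA; apply: mulmx_entry_bound => l.
    by have := outK x x0 l; rewrite !mxE.
  move/cvgrPdist_lt: cont => /(_ `|affine_layer W b (out j x0) i 0|).
  rewrite normr_gt0 pre0// => /(_ isT).
  by apply: filterS => x; rewrite distrC.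
near=> x => u.
have xstable : forall i : 'I_(width d c n j.+1),
    `|affine_layer W b (out j x) i 0 - affine_layer W b (out j x0) i 0| <
    `|affine_layer W b (out j x0) i 0| by near: x.
have -> : out j.+1 x - out j.+1 x0 =
    active_linear_layer W b (@relu R) x0 j *m (out j x - out j x0).
  rewrite /active_linear_layer -mulmxA -affine_layerB /activation_mx mul_diag_mx.
  apply/matrixP => i l; rewrite (ord1 l).
  have -> : (out j.+1 x - out j.+1 x0) i 0 = out j.+1 x i 0 - out j.+1 x0 i 0.
    by rewrite !mxE.
  rewrite [RHS]mxE [X in X * _]mxE !layer_outS relu_near ?pre0//.
  by congr (_ * _); rewrite !mxE.
(* The active matrix moves onto the covector, [u^T A = (A^T u)^T], following the recursion of
   [active_tr_prod]. *)
rewrite mulmxA -[u^T *m _]trmxK trmx_mul trmxK.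
have -> // : forall w : 'cV[R]_(width d c n j), w^T *m (out j x - out j x0) =
    (active_tr_prod W b (@relu R) x0 w)^T *m (x - x0).
near: x; exact: IHj (ltnW jM).
Unshelve. all: by end_near. Qed.

Lemma features_near_affine M (J : {set 'I_M}) (x0 : 'cV[R]_d) :
  (forall j, (j < M)%N -> forall i : 'I_(width d c n j.+1),
     affine_layer W b (out j x0) i 0 != 0) ->
  \forall x \near x0, forall ik, features W b (@relu R) J x0 x ik =
    \sum_k feature_covector W b (@relu R) x0 ik k 0 * (x k 0 - x0 k 0).
Proof.
move=> pre0; apply: (@filter_forall _ (feature_index c J) _ (nbhs x0) _) => ik.
(* An index [i < M] denotes layer [i + 1], so [ltn_ord] is read as [i.+1 <= M]. *)
have := layer_out_near_affine pre0 (ltn_ord (val (tag ik))).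
apply: filterS => x /(_ (mean_covector R d n (tagged ik))) affine.
rewrite ffunE !channel_mean_covector.
have -> : forall A B : 'M[R]_1, A 0 0 - B 0 0 = (A - B) 0 0.
  by move=> A B; rewrite !mxE.
rewrite -mulmxBr affine mxE; apply: eq_bigr => k _.
by rewrite !mxE.
Qed.

Lemma features_lipschitz M (J : {set 'I_M}) (x0 : 'cV[R]_d) : exists K, 0 <= K /\
  forall x y ik, `|features W b (@relu R) J x0 x ik -
                   features W b (@relu R) J x0 y ik| <= K * `|x - y|.
Proof.
(* The constants are chosen as a function of the index so that they can be summed. *)
have H (ik : feature_index c J) : {K | 0 <= K /\ forall x y,
    `|features W b (@relu R) J x0 x ik -
      features W b (@relu R) J x0 y ik| <= K * `|x - y|}.
  apply: cid; have [K [K0 outK]] := layer_out_lipschitz (val (tag ik)).+1.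
  pose u := mean_covector R d n (tagged ik).
  exists ((\sum_l `|u^T 0 l|) * K); split; first by rewrite mulr_ge0// sumr_ge0.
  move=> x y; rewrite !ffunE !channel_mean_covector opprB addrA subrK.
  have -> : forall A B : 'M[R]_1, A 0 0 - B 0 0 = (A - B) 0 0.
    by move=> A B; rewrite !mxE.
  rewrite -mulmxBr -mulrA; apply: mulmx_entry_bound => l.
  by rewrite !mxE; have := outK x y l; rewrite !mxE.
exists (\sum_ik sval (H ik)); split.
  by apply: sumr_ge0 => ik _; have [] := svalP (H ik).
move=> x y ik; have [_ HK] := svalP (H ik); rewrite (le_trans (HK x y))//.
rewrite ler_wpM2r// (bigD1 ik)//= lerDl sumr_ge0// => jk _.
by have [] := svalP (H jk).
Qed.

End ReluNetwork.

Theorem proposition7 (R : realType) (M d : nat) (c n : nat -> nat)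
  (W : forall j (k : 'I_(c j.+1)), 'M[R]_(n j.+1, width d c n j))
  (b : forall j (k : 'I_(c j.+1)), 'cV[R]_(n j.+1))
  (J : {set 'I_M}) (x0 : 'cV[R]_d)
  (mu : probability (borelRn R d) R)
  (hM : (1 <= M)%N) (hd : (0 < d)%N)
  (hc : forall j, (1 <= j <= M)%N -> (0 < c j)%N)
  (hn : forall j, (1 <= j <= M)%N -> (0 < n j)%N)
  (hmoment : exists alpha eta : R, [/\ 1 < alpha, 0 < eta &
     (\int[mu]_x (expR (eta * enorm x `^ alpha))%:E < +oo)%E])
  (hopen : forall A : set 'cV[R]_d, open A -> A !=set0 -> (0 < mu A)%E)
  (hpreact : forall j, (j < M)%N -> forall i : 'I_(width d c n j.+1),
     affine_layer W b (layer_out W b (@relu R) j x0) i 0 != 0)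
  (hfree : free [seq feature_covector W b (@relu R) x0 ik
                | ik : feature_index c J]) :
  exists theta : {ffun feature_index c J -> R},
    is_dual_solution mu (features W b (@relu R) J x0) theta /\
    exists nu : probability (borelRn R d) R,
      is_gibbs mu (features W b (@relu R) J x0) theta nu /\
      is_the_primal_solution mu (features W b (@relu R) J x0) nu.
Proof.
set F := features W b (@relu R) J x0.
have [K [K0 FK]] := features_lipschitz W b J x0.
have mF ik : measurable_fun setT (fun x : borelRn R d => F x ik).
  apply: continuous_borelRn_measurable => x; apply: lipschitz_at_continuous.
  by exists K => y _; exact: FK.
(* From [F x0 = 0] one gets [|F x| <= K (|x| + |x0|)]; this [C] absorbs both terms, and the leading
   1 secures [1 <= C]. *)
pose C := 1 + K * (1 + `|x0|).
have C1 : 1 <= C by rewrite lerDl mulr_ge0// addr_ge0.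
have FC x ik : `|F x ik| <= C * (1 + enorm x).
  have Fx0 : F x0 ik = 0 by rewrite ffunE subrr.
  have := FK x x0 ik; rewrite -/F Fx0 subr0 => /le_trans; apply.
  apply: (@le_trans _ _ (K * (enorm x + `|x0|))).
    by rewrite ler_wpM2l// (le_trans (ler_normB _ _))// lerD2r ler_norm_enorm.
  have Kx0 : 0 <= K * `|x0| by rewrite mulr_ge0.
  have Kx0x : 0 <= K * `|x0| * enorm x by exact: mulr_ge0 Kx0 (enorm_ge0 x).
  by have x_ge0 := enorm_ge0 x; rewrite /C; lra.
have exp_int := exp_enorm_integrable hmoment.
have expN := exp_growth_integrable C exp_int.
have N0 (x : borelRn R d) : 0 <= C * (1 + enorm x).
  exact: mulr_ge0 (le_trans ler01 C1) (addr_ge0 ler01 (enorm_ge0 x)).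
(* Full support, nonzero pre-activations and freeness combine here into coercivity. *)
have [m [a [m0 a0 coercive]]] := partition_coercive hopen
  (integrable_expdot mF N0 FC expN) (features_near_affine J hpreact) hfree.
have [theta theta_min] := partition_minimum mF N0 FC expN m0 a0 coercive.
exists theta; apply: (maximum_entropy_duality mF C1 FC exp_int).
by move=> ik; exact: (partition_stationary mF N0 FC expN theta_min).
Qed.
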